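(* Given any compact length space $M$ and any $k\in\mathbb{N}$, the set $L_{1/k}(M)\cup\{0\}\subset\mathbb{R}$ is compact.
   Context: A compact length space is a compact metric space in which every pair of points is joined by a rectifiable curve whose length equals the distance between the points. $S^1=\mathbb{R}/2\pi\mathbb{Z}$. A closed geodesic in $M$ is a nonconstant map $\gamma:S^1\to M$ that is locally length minimizing around every point of $S^1$, parametrized proportionally to arclength with speed $L(\gamma)/(2\pi)$, where $L(\gamma)$ is its length. A $1/k$ geodesic is a closed geodesic $\gamma$ with $d(\gamma(t),\gamma(t+2\pi/k))=L(\gamma)/k$ for all $t\in S^1$. $L_{1/k}(M)$ is the set of lengths of $1/k$ geodesics in $M$. *)

(* Defs.v *)
From HB Require Import structures.
From mathcomp Require Import all_boot all_order all_algebra ring_quotient.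
From mathcomp Require Import all_classical all_reals all_analysis.

Set Implicit Arguments.
Unset Strict Implicit.
Unset Printing Implicit Defensive.

Import Order.TTheory GRing.Theory Num.Theory.
Import numFieldNormedType.Exports.

Local Open Scope classical_set_scope.
Local Open Scope ring_scope.

Section Curves.
Context {R : realType} {M : metricType R}.
Implicit Types (f : R -> M) (a b : R).

(* The metric counterpart of [variation] and [total_variation] of realfun:
   [itv_partition a b s] says that [a :: s] is increasing with last element
   [b], so the supremum below is meaningful for [a <= b] only. *)
Definition polygonal_length a b f (s : seq R) : R :=
  let F := f \o nth b (a :: s) in
  \sum_(0 <= n < size s) mdist (F n) (F n.+1).

Definition curve_length a b f : \bar R :=
  ereal_sup [set (polygonal_length a b f s)%:E | s in itv_partition a b].

Definition curve_from_to a b f (x y : M) : Prop :=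
  [/\ a <= b, {within `[a, b], continuous f}, f a = x & f b = y].

Definition length_minimizing a b f : Prop :=
  forall (a' b' : R) (c : R -> M), curve_from_to a' b' c (f a) (f b) ->
    (curve_length a b f <= curve_length a' b' c)%E.

End Curves.

Definition compact_length_space (R : realType) (M : metricType R) : Prop :=
  compact [set: M] /\
  forall x y : M, exists (a b : R) (c : R -> M),
    curve_from_to a b c x y /\ curve_length a b c = (mdist x y)%:E.

Section Circle.
Context (R : realType).

Definition two_pi_int : {pred R} := [pred x | x / (2 * pi) \is a Num.int].

Lemma two_pi_int_zmod : zmod_closed two_pi_int.
Proof.
split=> [|x y]; rewrite !inE /= ?mul0r ?int_num0 // => xZ yZ.
by rewrite mulrBl rpredB.
Qed.

HB.instance Definition _ :=
  GRing.isZmodClosed.Build R two_pi_int two_pi_int_zmod.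

Definition circle : zmodType := Quotient.quot two_pi_int.

Definition to_circle (t : R) : circle :=
  \pi_(Quotient.quot two_pi_int)%qT t.

Lemma to_circle_eq (s t : R) :
  to_circle s = to_circle t <-> exists m : int, s - t = m%:~R * (2 * pi).
Proof.
have pi2 : 2 * pi != 0 :> R by rewrite mulf_neq0 // gt_eqF // pi_gt0.
rewrite /to_circle; split.
  move/eqP; rewrite -Quotient.idealrBE inE /= => /intrP[m mE].
  by exists m; rewrite -mE divfK.
case=> m mE; apply/eqP; rewrite -Quotient.idealrBE inE /= mE mulfK // ?intr_int.
Qed.

Lemma to_circleD (s t : R) : to_circle (s + t) = to_circle s + to_circle t.
Proof. by rewrite /to_circle /circle !piE. Qed.

End Circle.

Section ClosedGeodesics.
Context {R : realType} {M : metricType R}.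
Implicit Types (g : circle R -> M).

Definition unroll g : R -> M := fun t => g (to_circle t).

Definition loop_length g : \bar R := curve_length 0 (2 * pi) (unroll g).

Definition locally_minimizing g : Prop :=
  forall t : R, exists2 e : R, 0 < e &
    length_minimizing (t - e) (t + e) (unroll g).

(* For [a = 0] and [b = 2 * pi] the equation forces [loop_length g] to be
   finite, so [fine] loses nothing; it also makes [g] Lipschitz, which is why
   continuity of a closed geodesic is not required separately. *)
Definition proportional_to_arclength g : Prop :=
  forall a b : R, a <= b ->
    curve_length a b (unroll g) =
      (fine (loop_length g) / (2 * pi) * (b - a))%:E.

Definition closed_geodesic g : Prop :=
  [/\ exists s t, g s <> g t, locally_minimizing g
    & proportional_to_arclength g].

Definition one_over_geodesic (k : nat) g : Prop :=
  closed_geodesic g /\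
  forall t, mdist (g t) (g (t + to_circle (2 * pi / k%:R))) =
    fine (loop_length g) / k%:R.

End ClosedGeodesics.

Definition length_spectrum_one_over (R : realType) (M : metricType R)
    (k : nat) : set R :=
  [set fine (loop_length g) | g in [set g : circle R -> M |
    one_over_geodesic k g]].

(* Main.v *)
Require Import Defs.
From mathcomp Require Import all_boot all_order all_algebra.
From mathcomp Require Import all_classical all_reals all_analysis.
From mathcomp Require Import ring lra.

(** A 1/k geodesic of length [L] has speed [c = L / (2 * pi)], and its arcs over
parameter intervals of length [d = 2 * pi / k] realize the distance between
their endpoints. By the triangle inequality so do all shorter arcs, hence

  mdist (g s) (g t) = c * (t - s)   whenever   s <= t <= s + d.        (E)

Conversely (E) with [c > 0] determines everything: polygonal lengths for fine
partitions of [a, b] equal [c * (b - a)], so this is the length of the arc;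
arcs over intervals of length at most [d] are minimizing; and (E) at
[t = s + d] is the 1/k condition ([one_over_geodesic_rescaled],
[rescaled_one_over_geodesic]).

The advantage of (E) is that it is a family of equations between distances of
values of [g], so it survives pointwise limits, whereas being locally
minimizing in general does not: the size of the minimizing arcs could shrink.
Since [L] is itself [k] times the distance from [g 0] to [g (2 * pi / k)], the
solutions of (E) form a closed subset of the product of copies of [M] indexed by
the circle, which is compact by Tychonoff's theorem, and [L] is a continuous
function on it. The set of lengths is therefore the continuous image of a
compact set, up to the length [0] of the constant maps, which also solve (E). *)

Set Implicit Arguments.
Unset Strict Implicit.
Unset Printing Implicit Defensive.

Import Order.TTheory GRing.Theory Num.Theory.
Import numFieldNormedType.Exports.
Local Open Scope classical_set_scope.
Local Open Scope ring_scope.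

(** * Curves that are minimizing at a fixed scale *)

Section Length.
Context {R : realType} {M : metricType R}.
Implicit Types (f : R -> M) (a b c d : R) (s : seq R).

Lemma polygonal_length_cons a b f x s :
  polygonal_length a b f (x :: s) =
  mdist (f a) (f x) + polygonal_length x b f s.
Proof. by rewrite /polygonal_length /= big_nat_recl. Qed.

Lemma mdist_le_polygonal_length a b f s : itv_partition a b s ->
  mdist (f a) (f b) <= polygonal_length a b f s.
Proof.
elim: s a => [a /itv_partition_nil ->|x s IHs a /itv_partition_cons abs].
  by rewrite mdistxx /polygonal_length big_geq.
rewrite polygonal_length_cons (le_trans (metric_triangle _ (f x) _))//.
by rewrite lerD2l IHs.
Qed.

Lemma polygonal_le_curve_length a b f s : itv_partition a b s ->
  ((polygonal_length a b f s)%:E <= curve_length a b f)%E.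
Proof. by move=> abs; apply: ereal_sup_ubound; exists s. Qed.

Lemma mdist_le_curve_length a b f : a <= b ->
  ((mdist (f a) (f b))%:E <= curve_length a b f)%E.
Proof.
have ub s : itv_partition a b s ->
    ((mdist (f a) (f b))%:E <= curve_length a b f)%E.
  move=> abs; apply: le_trans (polygonal_le_curve_length f abs).
  by rewrite lee_fin mdist_le_polygonal_length.
rewrite le_eqVlt => /predU1P[ab|ab]; last exact: ub (itv_partition1 ab).
by apply: (ub [::]); rewrite ab; split => /=.
Qed.

(** Equation (E). Fixing the scale [d] once for the whole curve is what makes
this condition stable under pointwise limits. *)
Definition minimizing_at_scale c d f :=
  forall s t : R, s <= t <= s + d -> mdist (f s) (f t) = c * (t - s).

(** Steps of size [d], with a last shorter one, have lengths that add up exactly.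
Only one such partition is needed: it bounds the length of the arc from below,
and through the triangle inequality it makes [f] globally [c]-Lipschitz, which
bounds the length from above. *)
Lemma polygonal_length_at_scale c d f a b : 0 < d -> a <= b ->
  minimizing_at_scale c d f ->
  exists2 s, itv_partition a b s & polygonal_length a b f s = c * (b - a).
Proof.
move=> d0 ab fcd; have [n] : exists n : nat, b - a <= n%:R * d.
  exists (Num.truncn ((b - a) / d)).+1; rewrite -ler_pdivrMr// ltW//.
  by rewrite truncnS_gt.
elim: n a ab => [|n IHn] a ab ban.
  have -> : a = b by apply/eqP; rewrite eq_le ab/= -subr_le0 -(mul0r d).
  by exists [::]; [split=> /= | rewrite /polygonal_length big_geq// subrr mulr0].
have [bad|adb] := leP b (a + d).
  move: ab; rewrite le_eqVlt => /predU1P[->|ab].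
    by exists [::]; [split=> /= | rewrite /polygonal_length big_geq// subrr mulr0].
  exists [:: b]; first exact: itv_partition1.
  rewrite polygonal_length_cons /polygonal_length big_geq// addr0 fcd//.
  by rewrite (ltW ab).
have [||s [pas las] sE] := IHn (a + d).
- exact: ltW.
- by move: ban; rewrite -natr1 mulrDl mul1r; lra.
exists ((a + d) :: s).
  by split => //=; rewrite ltrDl d0.
rewrite polygonal_length_cons sE fcd; first by ring.
by rewrite lexx andbT lerDl ltW.
Qed.

Lemma mdist_le_at_scale c d f a b : 0 < d -> a <= b ->
  minimizing_at_scale c d f -> mdist (f a) (f b) <= c * (b - a).
Proof.
move=> d0 ab /(polygonal_length_at_scale d0 ab)[s abs <-].
exact: mdist_le_polygonal_length.
Qed.

Lemma curve_length_at_scale c d f a b : 0 < d -> a <= b ->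
  minimizing_at_scale c d f -> curve_length a b f = (c * (b - a))%:E.
Proof.
move=> d0 ab fcd; apply/eqP; rewrite eq_le; apply/andP; split; last first.
  have [s abs <-] := polygonal_length_at_scale d0 ab fcd.
  exact: polygonal_le_curve_length.
apply: ge_ereal_sup => _ [s abs <-]; rewrite lee_fin.
elim: s a {ab} abs => [a /itv_partition_nil ->|x s IHs a abs].
  by rewrite /polygonal_length big_geq// subrr mulr0.
have ax : a <= x by have [/= /andP[/ltW]] := abs.
rewrite polygonal_length_cons.
have -> : c * (b - a) = c * (x - a) + c * (b - x) by ring.
by rewrite lerD ?(mdist_le_at_scale d0)//; exact: IHs (itv_partition_cons abs).
Qed.

(** Any competing curve is at least as long as the distance between its
endpoints, which at this scale is the length of [f]. *)
Lemma length_minimizing_at_scale c d f a b : 0 < d -> a <= b <= a + d ->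
  minimizing_at_scale c d f -> length_minimizing a b f.
Proof.
move=> d0 abd fcd a' b' h [ab' _ ha hb].
have /andP[ab _] := abd.
rewrite (curve_length_at_scale d0 ab fcd) -(fcd _ _ abd) -ha -hb.
exact: mdist_le_curve_length.
Qed.

(** The length bounds the distance over [s, t] and over [t, s + d]; equality over
[s, s + d] forces equality in both. *)
Lemma minimizing_at_scale_of_length c d f :
  (forall a b, a <= b -> curve_length a b f = (c * (b - a))%:E) ->
  (forall t, mdist (f t) (f (t + d)) = c * d) ->
  minimizing_at_scale c d f.
Proof.
move=> fc fd s t /andP[st td].
have lip a b : a <= b -> mdist (f a) (f b) <= c * (b - a).
  by move=> ab; rewrite -lee_fin -fc// mdist_le_curve_length.
apply/eqP; rewrite eq_le lip//=.
have := metric_triangle (f s) (f t) (f (s + d)).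
by have := lip _ _ td; rewrite fd; lra.
Qed.

End Length.

(** * Characterization of 1/k geodesics *)

Section OneOverGeodesics.
Context {R : realType} {M : metricType R}.
Implicit Types g : circle R -> M.

Let pi2_gt0 : 0 < 2 * pi :> R. Proof. by rewrite mulr_gt0// pi_gt0. Qed.

(** The length of [g], recovered from two of its values when [g] is a 1/k
geodesic; unlike [loop_length] it is continuous for pointwise convergence. *)
Definition step_length (k : nat) g : R :=
  k%:R * mdist (unroll g 0) (unroll g (2 * pi / k%:R)).

Definition rescaled_steps (k : nat) : set (circle R -> M) :=
  [set g | minimizing_at_scale (step_length k g / (2 * pi)) (2 * pi / k%:R)
    (unroll g)].

Lemma to_circle_surj (x : circle R) : exists t, to_circle t = x.
Proof. by exists (repr x); rewrite /to_circle reprK. Qed.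

Lemma one_over_geodesic_rescaled k g : (0 < k)%N -> one_over_geodesic k g ->
  rescaled_steps k g /\ step_length k g = fine (loop_length g).
Proof.
move=> k0 [[_ _ gL] gk].
have kn0 : k%:R != 0 :> R by rewrite pnatr_eq0 -lt0n.
have step t : mdist (unroll g t) (unroll g (t + 2 * pi / k%:R)) =
    fine (loop_length g) / k%:R.
  by rewrite /unroll to_circleD gk.
have gE : step_length k g = fine (loop_length g).
  by have := step 0; rewrite add0r /step_length => ->; rewrite mulrC divfK.
split=> //; rewrite /rescaled_steps /= gE.
apply: minimizing_at_scale_of_length => [a b /gL //|t].
by rewrite step mulrA divfK// gt_eqF.
Qed.

(** A nonzero [step_length] excludes exactly the constant maps among the
solutions of (E). For [k = 1] the hypotheses are contradictory, as
[step_length] is then the distance from a point to itself. *)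
Lemma rescaled_one_over_geodesic k g : (0 < k)%N -> rescaled_steps k g ->
  step_length k g != 0 ->
  one_over_geodesic k g /\ fine (loop_length g) = step_length k g.
Proof.
move=> k0 gk L0.
have k_gt0 : 0 < k%:R :> R by rewrite ltr0n.
have pi2k : 0 < 2 * pi / k%:R :> R by rewrite divr_gt0.
have len a b (ab : a <= b) := curve_length_at_scale pi2k ab gk.
have gL : fine (loop_length g) = step_length k g.
  by rewrite /loop_length len ?ltW//= subr0 divfK// gt_eqF.
split=> //; split; first split.
- exists (to_circle 0), (to_circle (2 * pi / k%:R)) => g0.
  by move: L0; rewrite /step_length /unroll g0 mdistxx mulr0 eqxx.
- (* an interval of radius [pi / k] has exactly the length of one step *)
  move=> t; exists (pi / k%:R); first by rewrite divr_gt0// pi_gt0.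
  apply: (length_minimizing_at_scale pi2k _ gk).
  have pik : 0 < pi / k%:R :> R by rewrite divr_gt0// pi_gt0.
  by rewrite -mulrA; apply/andP; split; lra.
- by move=> a b ab; rewrite gL len.
- move=> x; have [t <-] := to_circle_surj x.
  rewrite -to_circleD [LHS]gk ?lexx ?lerDl ?(ltW pi2k)//.
  by rewrite gL addrAC subrr add0r mulrA divfK// gt_eqF.
Qed.

Lemma length_spectrum_one_over_steps k : (0 < k)%N ->
  length_spectrum_one_over M k `|` [set 0] =
  step_length k @` rescaled_steps k `|` [set 0].
Proof.
move=> k0; apply/seteqP; split=> x [[g gk <-]|->]; try by right.
  by left; have [gr <-] := one_over_geodesic_rescaled k0 gk; exists g.
have [->|L0] := eqVneq (step_length k g) 0; first by right.
by left; have [gg gE] := rescaled_one_over_geodesic k0 gk L0; exists g.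
Qed.

End OneOverGeodesics.

(** * Compactness in the topology of pointwise convergence *)

Section Compactness.
Context {R : realType} {M : metricType R}.

Lemma continuous_mdist (T : topologicalType) (f g : T -> M) :
  continuous f -> continuous g -> continuous (fun t => mdist (f t) (g t)).
Proof.
move=> fc gc u; apply/cvgrPdist_lt => e e0.
have e2 : 0 < e / 2 by rewrite divr_gt0.
near=> t.
have fut : mdist (f u) (f t) < e / 2.
  by near: t; exact: (metricType_numDomainType.cvgr_dist_lt (fc u)).
have gut : mdist (g u) (g t) < e / 2.
  by near: t; exact: (metricType_numDomainType.cvgr_dist_lt (gc u)).
have := metric_triangle (f u) (f t) (g u).
have := metric_triangle (f t) (g t) (g u).
have := metric_triangle (f t) (f u) (g t).
have := metric_triangle (f u) (g u) (g t).
rewrite (metric_sym (f t) (f u)) (metric_sym (g t) (g u)) ltr_norml.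
by move=> *; apply/andP; split; lra.
Unshelve. all: by end_near. Qed.

Lemma continuous_mdist_eval (I : eqType) (i j : I) :
  continuous (fun g : {ptws I -> M} => mdist (g i) (g j) : R).
Proof.
have eval_continuous l := @proj_continuous I (fun=> M : topologicalType) l.
exact: (@continuous_mdist {ptws I -> M} _ _
  (eval_continuous i) (eval_continuous j)).
Qed.

Lemma continuous_step_length k :
  continuous (step_length k : {ptws circle R -> M} -> R).
Proof.
move=> g; apply: (@continuousM _ {ptws circle R -> M}).
  exact: (@cst_continuous {ptws circle R -> M}).
exact: continuous_mdist_eval.
Qed.

(** An intersection, over the pairs of parameters at distance at most
[2 * pi / k], of zero sets of functions continuous for pointwise convergence. *)
Lemma closed_rescaled_steps k :
  closed (rescaled_steps k : set {ptws circle R -> M}).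
Proof.
pose P := [set p : R * R | p.1 <= p.2 <= p.1 + 2 * pi / k%:R].
pose defect (p : R * R) (g : {ptws circle R -> M}) : R :=
  mdist (unroll g p.1) (unroll g p.2)
  - step_length k g / (2 * pi) * (p.2 - p.1).
have -> : rescaled_steps k = \bigcap_(p in P) (defect p @^-1` [set 0]).
  apply/seteqP; split=> g.
    by move=> gk p /gk; rewrite /defect /= => ->; rewrite subrr.
  by move=> gk s t st; apply/eqP; rewrite -subr_eq0; apply/eqP/(gk (s, t)).
apply: closed_bigI => p _; apply: preimage_closed; last exact: closed_eq.
move=> g _; apply: (@continuousB _ _ {ptws circle R -> M}).
  exact: continuous_mdist_eval.
do 2![apply: (@continuousM _ {ptws circle R -> M});
  last exact: (@cst_continuous {ptws circle R -> M})].
exact: continuous_step_length.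
Qed.

Lemma compact_rescaled_steps k : compact [set: M] ->
  compact (rescaled_steps k : set {ptws circle R -> M}).
Proof.
move=> cM; apply: (subclosed_compact (@closed_rescaled_steps k)
  (tychonoff (fun _ : circle R => cM))) => g _ x //.
Qed.

End Compactness.

Theorem corollary7p3 (R : realType) (M : metricType R) (k : nat) :
  compact_length_space M -> (0 < k)%N ->
  compact (length_spectrum_one_over M k `|` [set 0]).
Proof.
move=> [cM _] k0; rewrite length_spectrum_one_over_steps//.
apply: compactU; last exact: compact_set1.
apply: (@continuous_compact {ptws circle R -> M}).
  exact/continuous_subspaceT/continuous_step_length.
exact: compact_rescaled_steps.
Qed.
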